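(* Let $\kappa$ be a positive integer and $u>0$ a real number. Then for every integer $n\ge 0$ and every $x\in\mathbb{R}$, $$\lim_{a\to 1}(a-1)^n\, m_n^{a,\,\kappa+1+(1-a)^{\kappa}/u;\,\kappa}\!\left(\frac{x}{1-a}\right)=L_n^{\kappa;u}(x),$$ where $m_n^{a,c;\kappa}$ (taken with $c=\kappa+1+(1-a)^\kappa/u$) are the Krall Meixner polynomials and $L_n^{\kappa;u}$ the Krall Laguerre polynomials, both defined in the context.
   Context: Binomials with real upper entry are generalized: $\binom{y}{j}=y(y-1)\cdots(y-j+1)/j!$; $(y)_j=y(y+1)\cdots(y+j-1)$ is the Pochhammer symbol. Meixner polynomials: for $a\ne 0,1$ and real $c$, $m_n^{a,c}(x)=\frac{a^n}{(1-a)^n}\sum_{j=0}^n a^{-j}\binom{x}{j}\binom{-x-c}{n-j}$ for $n\ge 0$, and $m_{-1}^{a,c}=0$. Laguerre polynomials: $L_n^{\alpha}(x)=\sum_{j=0}^n\frac{(-x)^j}{j!}\binom{n+\alpha}{n-j}$ for $n\ge0$, $L_{-1}^\alpha=0$. Krall Meixner polynomials: for a positive integer $\kappa$, $m_0^{a,c;\kappa}=1$ and for $n\ge 1$ $$m_n^{a,c;\kappa}(x)=m_n^{a,c}(x)+\frac{a\,m_{\kappa}^{1/a,2-c}(-n-1)}{(1-a)\,m_{\kappa}^{1/a,2-c}(-n)}\,m_{n-1}^{a,c}(x),$$ defined whenever $m_{\kappa}^{1/a,2-c}(-n)\ne 0$; the limit is taken through values of $a$ for which this holds. (When $0<a<1$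 and $c>\kappa+1$ the denominators do not vanish, and these polynomials are orthogonal with respect to $\sum_{x\ge 0}\prod_{j=1}^{\kappa}(x+c-j)\frac{a^x\Gamma(x+c-\kappa-1)}{x!}\delta_x$.) Krall Laguerre polynomials: for a positive integer $\kappa$ and $u>0$, $L_0^{\kappa;u}=1$ and for $n\ge1$ $$L_n^{\kappa;u}(x)=L_n^{\kappa}(x)-\frac{(\kappa-1)!+u\,(n+1)_{\kappa}}{(\kappa-1)!+u\,(n)_{\kappa}}L_{n-1}^{\kappa}(x)$$ (these are orthogonal with respect to the measure $x^{\kappa-1}e^{-x}dx+\kappa!\,u\,\delta_0$ on $[0,\infty)$). *)

(* Defs.v *)
From HB Require Import structures.
From mathcomp Require Import all_boot all_order all_algebra.
From mathcomp Require Import all_classical all_reals all_analysis.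

Set Implicit Arguments.
Unset Strict Implicit.
Unset Printing Implicit Defensive.

Import Order.TTheory GRing.Theory Num.Theory.
Import numFieldNormedType.Exports.

Local Open Scope classical_set_scope.
Local Open Scope ring_scope.

(* y (y - 1) ... (y - j + 1) / j! *)
Definition rbinom {R : realType} (y : R) (j : nat) : R :=
  (\prod_(i < j) (y - i%:R)) / (j`!)%:R.

(* y (y + 1) ... (y + j - 1) *)
Definition pochhammer {R : realType} (y : R) (j : nat) : R :=
  \prod_(i < j) (y + i%:R).

(* m_n^{a,c}(x), meaningful for a != 0, 1 *)
Definition meixner {R : realType} (n : nat) (a c x : R) : R :=
  a ^+ n / (1 - a) ^+ n *
  \sum_(j < n.+1) a ^- j * rbinom x j * rbinom (- x - c) (n - j).

Definition laguerre {R : realType} (n : nat) (alpha x : R) : R :=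
  \sum_(j < n.+1) (- x) ^+ j / (j`!)%:R * rbinom (n%:R + alpha) (n - j).

(* m_n^{a,c;k}(x); for n > 0 it is meaningful only where the denominator does
   not vanish, see [krall_meixner_defined]. *)
Definition krall_meixner {R : realType} (k n : nat) (a c x : R) : R :=
  if n is p.+1 then
    meixner n a c x +
    a * meixner k a^-1 (2 - c) (- n%:R - 1) /
      ((1 - a) * meixner k a^-1 (2 - c) (- n%:R)) * meixner p a c x
  else 1.

Definition krall_meixner_defined {R : realType} (k n : nat) (a c : R) : Prop :=
  [/\ a != 0, a != 1 &
      (0 < n)%N -> meixner k a^-1 (2 - c) (- n%:R) != 0].

(* L_n^{k;u}(x) *)
Definition krall_laguerre {R : realType} (k n : nat) (u x : R) : R :=
  if n is p.+1 then
    laguerre n k%:R x -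
    ((k.-1)`!%:R + u * pochhammer (n%:R + 1) k) /
      ((k.-1)`!%:R + u * pochhammer n%:R k) * laguerre p k%:R x
  else 1.

(* Main.v *)
Require Import Defs.
From HB Require Import structures.
From mathcomp Require Import all_boot all_order all_algebra.
From mathcomp Require Import all_classical all_reals all_analysis.
From mathcomp Require Import ring.

Import Order.TTheory GRing.Theory Num.Theory.
Import numFieldNormedType.Exports.

(** Re-expanding a^(-j) around 1 and applying Vandermonde's identity turns the
Meixner sum into a sum over binom(x, j) (1/a - 1)^j binom(-c-j, n-j), in which
every term of (a-1)^n m_n(x/(1-a)) has a finite limit as a -> 1.  The same
expansion of m_k^{1/a,2-c}(-y), with c = k + 1 + (1-a)^k/u, shows that it tends
to (-1)^k ((k-1)! + u (y)_k) / (u k!), which is nonzero at y = n; the quotient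
of the limits at y = n + 1 and y = n is the Krall Laguerre coefficient. *)

Local Open Scope classical_set_scope.
Local Open Scope ring_scope.

(** * Binomials with a real upper entry *)

Lemma fact_neq0 (R : realType) (n : nat) : (n`!)%:R != 0 :> R.
Proof. by rewrite pnatr_eq0 -lt0n fact_gt0. Qed.

Lemma rbinom0 (R : realType) (y : R) : rbinom y 0 = 1.
Proof. by rewrite /rbinom big_ord0 divr1. Qed.

Lemma rbinomS (R : realType) (y : R) (j : nat) :
  j.+1%:R * rbinom y j.+1 = (y - j%:R) * rbinom y j.
Proof.
rewrite /rbinom big_ord_recr /= factS natrM.
have h1 := fact_neq0 R j; have h2 : j.+1%:R != 0 :> R by rewrite pnatr_eq0.
by move: h2; move: (j.+1%:R) => d h2; field; rewrite h1 h2.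
Qed.

(** Induction on [n]: multiply by n+1 = j + (n+1-j), absorb each summand into its own binomial by
    [rbinomS], and use (x - j) + (y - (n-j)) = x + y - n. *)
Lemma rbinom_vandermonde (R : realType) (x y : R) (n : nat) :
  \sum_(j < n.+1) rbinom x j * rbinom y (n - j) = rbinom (x + y) n.
Proof.
elim: n => [|n IHn]; first by rewrite big_ord1 !rbinom0 mulr1.
have nz : n.+1%:R != 0 :> R by rewrite pnatr_eq0.
apply: (mulfI nz); rewrite rbinomS -IHn !mulr_sumr.
transitivity
  (\sum_(j < n.+2) (j%:R * rbinom x j) * rbinom y (n.+1 - j) +
   \sum_(j < n.+2) rbinom x j * ((n.+1 - j)%:R * rbinom y (n.+1 - j))).
  rewrite -big_split /=; apply: eq_bigr => j _.
  by rewrite natrB 1?leq_ord //; ring.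
rewrite big_ord_recl mul0r mul0r add0r.
rewrite [X in _ + X]big_ord_recr /= subnn mul0r mulr0 addr0 -big_split /=.
apply: eq_bigr => j _; rewrite /bump /= add1n subSS rbinomS.
rewrite subSn ?leq_ord // rbinomS natrB ?leq_ord //; ring.
Qed.

(** Trinomial revision: the falling product of length i + m is cut after its first i factors. *)
Lemma rbinom_mulbin (R : realType) (x : R) (i m : nat) :
  rbinom x (i + m) * ('C(i + m, i))%:R = rbinom x i * rbinom (x - i%:R) m.
Proof.
have bE : ('C(i + m, i))%:R = ((i + m)`!)%:R / ((i`!)%:R * (m`!)%:R) :> R.
  rewrite -natrM -[in RHS](bin_fact (leq_addr m i)) addKn.
  by rewrite natrM mulfK // natrM mulf_neq0 // fact_neq0.
rewrite bE /rbinom big_split_ord /=.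
under [X in _ * X / _ * _]eq_bigr => j _ do rewrite natrD opprD addrA.
have h1 := fact_neq0 R (i + m); have h2 := fact_neq0 R i.
by have h3 := fact_neq0 R m; field; rewrite h1 h2 h3.
Qed.

Lemma rbinomN (R : realType) (y : R) (m : nat) :
  rbinom (- y) m = (-1) ^+ m * (pochhammer y m / (m`!)%:R).
Proof.
rewrite /rbinom /pochhammer mulrA; congr (_ / _).
under eq_bigr => i _ do rewrite -opprD -mulN1r.
by rewrite big_split /= prodr_const card_ord.
Qed.

Lemma pochhammerE (R : realType) (y : R) (m : nat) :
  pochhammer y m / (m`!)%:R = rbinom (y + m%:R - 1) m.
Proof.
rewrite /rbinom /pochhammer; congr (_ / _).
rewrite (reindex_inj rev_ord_inj) /=; apply: eq_bigr => i _.
by rewrite natrB // -natr1; ring.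
Qed.

(* Comparing coefficients of z^n in
   (1 + b z)^X (1 + z)^Y = (1 + (b - 1) z / (1 + z))^X (1 + z)^(X + Y). *)
Lemma sum_rbinom_shift (R : realType) (b X Y : R) (n : nat) :
  \sum_(j < n.+1) b ^+ j * rbinom X j * rbinom Y (n - j) =
  \sum_(j < n.+1) rbinom X j * (b - 1) ^+ j * rbinom (X + Y - j%:R) (n - j).
Proof.
(* Expand b^j = (1 + (b-1))^j. The inner range is widened to a fixed bound with the guard i <= j, so
   that the two sums can be exchanged. *)
transitivity (\sum_(0 <= j < n.+1) \sum_(0 <= i < n.+1 | (i <= j)%N)
   (b - 1) ^+ i * (('C(j, i))%:R * rbinom X j) * rbinom Y (n - j)).
  rewrite big_mkord; apply: eq_bigr => j _.
  rewrite -{1}(subrK 1 b) addrC exprDn.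
  under eq_bigr => i _ do rewrite expr1n mul1r.
  rewrite -(big_mkord xpredT (fun i => (b - 1) ^+ i *+ 'C(j, i))).
  rewrite (big_nat_widen _ _ n.+1) // !mulr_suml.
  apply: eq_big => // i _.
  by rewrite -mulr_natr !mulrA.
rewrite (exchange_big_dep_nat xpredT) //= big_mkord; apply: eq_bigr => i _.
have lein : (i <= n)%N := leq_ord i.
(* The guard kills j < i; shifting the remaining j by i leaves a Vandermonde sum for X - i and Y. *)
rewrite (big_cat_nat (leq0n i)) /=; last exact: ltnW.
rewrite big_nat_cond big1 ?add0r => [|j /andP[/andP[_ ji]]]; last first.
  by rewrite leqNgt ji.
rewrite -{1}(add0n (i : nat)) big_addn subSn // big_mkord.
under eq_bigl => j do rewrite leq_addl.
have -> : X + Y - i%:R = X - i%:R + Y by ring.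
rewrite -rbinom_vandermonde mulr_sumr; apply: eq_bigr => j _.
rewrite [(j + i)%N]addnC (mulrC ('C(_, _))%:R) rbinom_mulbin subnDA; ring.
Qed.

(** * Meixner and Laguerre sums in a form suited to [a] near 1 *)

Lemma meixnerE (R : realType) (n : nat) (a c x : R) :
  meixner n a c x = a ^+ n / (1 - a) ^+ n *
    \sum_(j < n.+1) rbinom x j * (a^-1 - 1) ^+ j * rbinom (- c - j%:R) (n - j).
Proof.
rewrite /meixner; congr (_ * _).
under eq_bigr => j _ do rewrite -exprVn.
(* Here b = 1/a, X = x and Y = -x - c, so X + Y = -c is free of x. *)
rewrite sum_rbinom_shift; apply: eq_bigr => j _.
by congr (_ * rbinom _ _); ring.
Qed.

(** The factor (1-a)^j of (1/a - 1)^j clears the denominators of binom(x/(1-a), j), and (a-1)^n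
    cancels the pole of the prefactor: nothing singular at a = 1 remains. *)
Lemma scaled_meixnerE (R : realType) (n : nat) (a c x : R) :
  a != 0 -> a != 1 ->
  (a - 1) ^+ n * meixner n a c (x / (1 - a)) =
  (- a) ^+ n * \sum_(j < n.+1) (\prod_(i < j) (x - i%:R * (1 - a))) / (j`!)%:R *
    a^-1 ^+ j * rbinom (- c - j%:R) (n - j).
Proof.
move=> a0 a1; have t0 : 1 - a != 0 by rewrite subr_eq0 eq_sym.
rewrite meixnerE mulrA; congr (_ * _).
  rewrite -expr_div_n -exprMn; congr (_ ^+ _); by field.
apply: eq_bigr => j _; congr (_ * _).
have -> : a^-1 - 1 = (1 - a) / a by field.
rewrite /rbinom exprMn mulrA; congr (_ * _).
rewrite mulrAC; congr (_ / _).
have -> : (1 - a) ^+ j = \prod_(i < j) (1 - a) by rewrite prodr_const card_ord.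
by rewrite -big_split /=; apply: eq_bigr => i _; field.
Qed.

(** Negating the upper entry gives the form that [scaled_meixnerE] takes at a = 1, c = alpha + 1. *)
Lemma laguerre_rbinomN (R : realType) (n : nat) (alpha x : R) :
  laguerre n alpha x =
  (-1) ^+ n * \sum_(j < n.+1) x ^+ j / (j`!)%:R *
    rbinom (- (alpha + 1) - j%:R) (n - j).
Proof.
rewrite /laguerre mulr_sumr; apply: eq_bigr => j _.
have jn : (j <= n)%N := leq_ord j.
rewrite -opprD rbinomN pochhammerE natrB // (exprNn x).
have -> : alpha + 1 + j%:R + (n%:R - j%:R) - 1 = n%:R + alpha by ring.
have -> : (-1) ^+ n = (-1) ^+ (n - j) * (-1) ^+ j :> R.
  by rewrite -exprD subnK.
have e : (-1) ^+ (n - j) * (-1) ^+ (n - j) = 1 :> R.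
  by rewrite -expr2 sqrr_sign.
move: e; move: ((-1) ^+ (n - j)) => s e.
rewrite -[LHS]mul1r -{1}e; ring.
Qed.

(** * Limits, and the Meixner to Laguerre limit *)

Lemma cvg_sum_ord (R : realType) (T : Type) (F : set_system T) (n : nat)
    (f : 'I_n -> T -> R) (l : 'I_n -> R) : Filter F ->
  (forall i, f i t @[t --> F] --> l i) ->
  \sum_(i < n) f i t @[t --> F] --> \sum_(i < n) l i.
Proof. by move=> FF h; apply: cvg_big => //; exact: add_continuous. Qed.

Lemma cvg_prod_ord (R : realType) (T : Type) (F : set_system T) (n : nat)
    (f : 'I_n -> T -> R) (l : 'I_n -> R) : Filter F ->
  (forall i, f i t @[t --> F] --> l i) ->
  \prod_(i < n) f i t @[t --> F] --> \prod_(i < n) l i.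
Proof. by move=> FF h; apply: cvg_big => //; exact: mul_continuous. Qed.

Lemma cvg_expr (R : realType) (T : Type) (F : set_system T) (n : nat)
    (f : T -> R) (l : R) : Filter F ->
  f t @[t --> F] --> l -> f t ^+ n @[t --> F] --> l ^+ n.
Proof.
move=> FF h; apply: (cvg_comp f (fun y => y ^+ n) h).
exact: exprn_continuous.
Qed.

Lemma cvg_rbinom (R : realType) (T : Type) (F : set_system T) (n : nat)
    (f : T -> R) (l : R) : Filter F ->
  f t @[t --> F] --> l -> rbinom (f t) n @[t --> F] --> rbinom l n.
Proof.
move=> FF h; apply: cvgM; last exact: cvg_cst.
by apply: cvg_prod_ord => i; apply: cvgB => //; exact: cvg_cst.
Qed.

Lemma cvg_dnbhs_id (R : realType) (b : R) : a @[a --> b^'] --> b.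
Proof. exact/continuous_withinNx/cvg_id. Qed.

Lemma near1_neq0 (R : realType) : \forall a \near (1 : R)^', a != 0.
Proof. exact: (cvgr_neq0 (1 : R) (@cvg_dnbhs_id R 1) (oner_neq0 R)). Qed.

(** The parameter [c] may vary with [a], as the Krall case requires; only its limit enters, by
    continuity of each term of [scaled_meixnerE]. *)
Lemma cvg_scaled_meixner (R : realType) (n : nat) (c : R -> R) (alpha x : R) :
  c a @[a --> (1 : R)^'] --> alpha + 1 ->
  (a - 1) ^+ n * meixner n a (c a) (x / (1 - a)) @[a --> (1 : R)^']
    --> laguerre n alpha x.
Proof.
move=> hc; have ha := @cvg_dnbhs_id R 1.
pose f (a : R) :=
  (- a) ^+ n * \sum_(j < n.+1) (\prod_(i < j) (x - i%:R * (1 - a))) / (j`!)%:R *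
    a^-1 ^+ j * rbinom (- c a - j%:R) (n - j).
apply: (@cvg_trans _ (f a @[a --> (1 : R)^'])).
  apply: near_eq_cvg; near=> a.
  rewrite /f scaled_meixnerE //; near: a; [exact: near1_neq0|].
  exact: nbhs_dnbhs_neq.
rewrite laguerre_rbinomN; apply: cvgM; first by apply: cvg_expr; exact: cvgN.
apply: cvg_sum_ord => j; apply: cvgM; last first.
  by apply: cvg_rbinom; apply: cvgB; [exact: cvgN|exact: cvg_cst].
rewrite -[X in _ --> X]mulr1; apply: cvgM.
  have -> : x ^+ j = \prod_(i < j) (x - i%:R * (1 - 1)).
    under eq_bigr => i _ do rewrite subrr mulr0 subr0.
    by rewrite prodr_const card_ord.
  apply: cvgM; last exact: cvg_cst.
  apply: cvg_prod_ord => i; apply: cvgB; first exact: cvg_cst.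
  by apply: cvgM; [exact: cvg_cst|apply: cvgB => //; exact: cvg_cst].
have := @cvg_expr R _ _ j _ _ _ (cvgV (oner_neq0 R) ha).
by rewrite invr1 expr1n; apply.
Unshelve. all: by end_near. Qed.

(** * The values of [meixner k] in the Krall coefficient *)

Lemma rbinom_near_int (R : realType) (m : nat) (e : R) :
  rbinom (m%:R + e) m.+1 =
  e * ((\prod_(i < m) (m%:R + e - i%:R)) / (m.+1)`!%:R).
(* The last factor of the falling product is m + e - m = e. *)
Proof. by rewrite /rbinom big_ord_recr /=; ring. Qed.

(** With k = p + 1, this is m_k^{1/a,2-c}(-y) up to the sign (-1)^k, written without division by 1 -
    a so that it can be evaluated at a = 1. The first summand is the term j = k of [meixnerE], the
    sum collects j < k. *)
Definition krall_factor {R : realType} (p : nat) (u y a : R) : R :=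
  pochhammer y p.+1 / (p.+1)`!%:R +
  u^-1 * \sum_(j < p.+1) rbinom (- y) j * (a - 1) ^+ j *
    ((\prod_(i < p - j) ((p - j)%:R + (1 - a) ^+ p.+1 / u - i%:R)) /
      (p - j).+1`!%:R).

(* For c = k + 1 + e with e = (1 - a)^k / u, each term j < k of [meixnerE] has
   the factor e, and the term j = k carries (1 - a)^k; this cancels the
   singular prefactor. *)
Lemma meixner_krall_factor (R : realType) (p : nat) (u y a : R) :
  u != 0 -> a != 0 -> a != 1 ->
  meixner p.+1 a^-1 (2 - (p.+1%:R + 1 + (1 - a) ^+ p.+1 / u)) (- y) =
  (-1) ^+ p.+1 * krall_factor p u y a.
Proof.
move=> u0 a0 a1; have t0 : 1 - a != 0 by rewrite subr_eq0 eq_sym.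
have t1 : a - 1 != 0 by rewrite subr_eq0.
set e := (1 - a) ^+ p.+1 / u.
rewrite meixnerE invrK.
have -> : a^-1 ^+ p.+1 / (1 - a^-1) ^+ p.+1 =
          (-1) ^+ p.+1 * ((1 - a) ^+ p.+1)^-1.
  rewrite -expr_div_n -exprVn -exprMn; congr (_ ^+ _).
  by field; rewrite a0 t0 t1.
rewrite -mulrA; congr (_ * _); rewrite big_ord_recr /= subnn rbinom0 mulr1 rbinomN.
rewrite mulrDr addrC; congr (_ + _).
  rewrite -[a - 1]opprB (exprNn (1 - a)).
  have s : (-1) ^+ p.+1 * (-1) ^+ p.+1 = 1 :> R by rewrite -expr2 sqrr_sign.
  have T0 : (1 - a) ^+ p.+1 != 0 by rewrite expf_neq0.
  move: s T0; move: ((-1) ^+ p.+1) ((1 - a) ^+ p.+1) => s T s2 T0.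
  move: (_ / (p.+1)`!%:R) => P.
  by rewrite -[RHS]mul1r -s2; field.
rewrite !mulr_sumr; apply: eq_bigr => j _.
have jp : (j <= p)%N := leq_ord j.
(* The upper entry is [e] above the integer p - j, one less than the lower index, so
   [rbinom_near_int] extracts [e]. *)
have -> : - (2 - (p.+1%:R + 1 + e)) - j%:R = (p - j)%:R + e.
  by rewrite natrB // -natr1; ring.
rewrite subSn // rbinom_near_int.
rewrite -/e; move: (_ / ((p - j).+1)`!%:R) => Q.
have : (1 - a) ^+ p.+1 != 0 by rewrite expf_neq0.
rewrite /e; move: ((1 - a) ^+ p.+1) => T T0.
by field; rewrite T0 u0.
Qed.

Lemma cvg_krall_factor (R : realType) (p : nat) (u y : R) : u != 0 ->
  krall_factor p u y a @[a --> (1 : R)^'] -->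
  (p`!%:R + u * pochhammer y p.+1) / (u * (p.+1)`!%:R).
Proof.
move=> u0; have ha := @cvg_dnbhs_id R 1.
have -> : (p`!%:R + u * pochhammer y p.+1) / (u * (p.+1)`!%:R) =
          krall_factor p u y 1.
  (* At a = 1 the powers (a-1)^j leave only j = 0, whose product is p!. *)
  rewrite /krall_factor big_ord_recl [\sum_(i < p) _]big1 => [|j _]; last first.
    by rewrite lift0 subrr (exprS _ j) !(mul0r, mulr0).
  rewrite /= subn0 rbinom0 expr0 !mul1r addr0 subrr expr0n /= mul0r addr0.
  have -> : \prod_(i < p) (p%:R - i%:R) = p`!%:R :> R.
    rewrite -ffactnn ffact_prod natr_prod; apply: eq_bigr => i _.
    by rewrite natrB // ltnW.
  by have h := fact_neq0 R p.+1; field; rewrite h u0.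
apply: cvgD; first exact: cvg_cst.
apply: cvgM; first exact: cvg_cst.
apply: cvg_sum_ord => j; apply: cvgM; first apply: cvgM.
- exact: cvg_cst.
- by apply: cvg_expr; apply: cvgB => //; exact: cvg_cst.
apply: cvgM; last exact: cvg_cst.
apply: cvg_prod_ord => i; apply: cvgB; last exact: cvg_cst.
apply: cvgD; first exact: cvg_cst.
apply: cvgM; last exact: cvg_cst.
by apply: cvg_expr; apply: cvgB => //; exact: cvg_cst.
Qed.

Lemma krall_laguerre_denom_gt0 (R : realType) (p n : nat) (u : R) : 0 < u ->
  0 < p`!%:R + u * pochhammer n%:R p.+1 :> R.
Proof.
move=> u0; apply: ltr_pwDl; first by rewrite ltr0n fact_gt0.
apply: mulr_ge0; first exact: ltW.
by apply: prodr_ge0 => i _; rewrite addr_ge0.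
Qed.

Lemma near_krall_factor_neq0 (R : realType) (p n : nat) (u : R) : 0 < u ->
  \forall a \near (1 : R)^', krall_factor p u n%:R a != 0.
Proof.
move=> u0; have un0 : u != 0 by rewrite gt_eqF.
apply: (cvgr_neq0 _ (@cvg_krall_factor R p u n%:R un0)).
by rewrite mulf_neq0 ?invr_eq0 ?mulf_neq0 ?fact_neq0 // gt_eqF //
  krall_laguerre_denom_gt0.
Qed.

Theorem mainTheorem2 (R : realType) (k : nat) (u : R)
    (hk : (0 < k)%N) (hu : 0 < u) (n : nat) (x : R) :
  let c := fun a : R => k%:R + 1 + (1 - a) ^+ k / u in
  let D := [set a : R | krall_meixner_defined k n a (c a)] in
  limit_point D 1 /\
  (a - 1) ^+ n * krall_meixner k n a (c a) (x / (1 - a))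
    @[a --> within D (1 : R)^'] --> krall_laguerre k n u x.
Proof.
case: k hk => // p _ c D; have un0 : u != 0 by rewrite gt_eqF.
have ha := @cvg_dnbhs_id R 1.
(* [D] contains a punctured neighbourhood of 1; hence 1 is a limit point of [D], and below the
   unrestricted punctured limit suffices. *)
have nearD : \forall a \near (1 : R)^', D a.
  near=> a.
  have a0 : a != 0 by near: a; exact: near1_neq0.
  have a1 : a != 1 by near: a; exact: nbhs_dnbhs_neq.
  split=> // _; rewrite meixner_krall_factor // mulf_neq0 ?signr_eq0 //.
  by near: a; exact: near_krall_factor_neq0.
split.
  move=> U U1.
  have nearU : \forall a \near (1 : R)^', [/\ a != 1, D a & U a].
    near=> a; split; near: a => //; first exact: nbhs_dnbhs_neq.
    exact: (@cvg_within _ (nbhs (1 : R))).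
  by have [a ?] := filter_ex nearU; exists a.
apply: cvg_within_filter.
case: n @D nearD => [|n] D _.
  by under eq_fun => a do rewrite mulr1; exact: cvg_cst.
have hc : c a @[a --> (1 : R)^'] --> (p.+1%:R + 1 : R).
  rewrite -[X in _ --> X]addr0; apply: cvgD; first exact: cvg_cst.
  have -> : 0 = (1 - 1) ^+ p.+1 / u :> R by rewrite subrr expr0n mul0r.
  apply: cvgM; last exact: cvg_cst.
  by apply: cvg_expr; apply: cvgB => //; exact: cvg_cst.
(* The signs (-1)^k cancel in the quotient, and (a-1)^(n+1) / (1-a) = -(a-1)^n produces the minus
   sign. *)
pose f (a : R) := (a - 1) ^+ n.+1 * meixner n.+1 a (c a) (x / (1 - a)) -
  a * (krall_factor p u (n.+1%:R + 1) a / krall_factor p u n.+1%:R a) *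
  ((a - 1) ^+ n * meixner n a (c a) (x / (1 - a))).
apply: (@cvg_trans _ (f a @[a --> (1 : R)^'])).
  apply: near_eq_cvg; near=> a.
  have a0 : a != 0 by near: a; exact: near1_neq0.
  have a1 : a != 1 by near: a; exact: nbhs_dnbhs_neq.
  have t0 : 1 - a != 0 by rewrite subr_eq0 eq_sym.
  have G0 : krall_factor p u n.+1%:R a != 0.
    by near: a; exact: near_krall_factor_neq0.
  have s0 : (-1) ^+ p.+1 != 0 :> R by rewrite signr_eq0.
  rewrite /f /krall_meixner -opprD !meixner_krall_factor //.
  move: s0; set s := (-1) ^+ p.+1 => s0.
  by rewrite exprS; field; rewrite G0 s0 t0.
apply: cvgB; first exact: cvg_scaled_meixner.
apply: cvgM; last exact: cvg_scaled_meixner.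
have d0 := @krall_laguerre_denom_gt0 R p n.+1 u hu.
(* The factor 1 is the limit of the leading [a]; the denominators u k! of the two limits cancel. *)
have -> : (p.+1.-1`!%:R + u * pochhammer (n.+1%:R + 1) p.+1) /
          (p.+1.-1`!%:R + u * pochhammer n.+1%:R p.+1) =
   1 * ((p`!%:R + u * pochhammer (n.+1%:R + 1) p.+1) / (u * (p.+1)`!%:R) /
     ((p`!%:R + u * pochhammer n.+1%:R p.+1) / (u * (p.+1)`!%:R))) :> R.
  have h := fact_neq0 R p.+1; have d1 := lt0r_neq0 d0.
  by field; rewrite d1 h un0.
apply: cvgM => //; apply: cvgM; first exact: cvg_krall_factor.
apply: cvgV; last exact: cvg_krall_factor.
by rewrite mulf_neq0 ?invr_eq0 ?mulf_neq0 ?fact_neq0 // gt_eqF.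
Unshelve. all: by end_near. Qed.
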